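(* For every integer $n\geq 3$ there exists a set of four $n$-sided dice $(A,B,C,D)$ that is balanced and non-transitive, i.e. $P(A\succ B)=P(B\succ C)=P(C\succ D)=P(D\succ A)>1/2$.
   Context: A set of four $n$-sided dice is an ordered quadruple $(A,B,C,D)$ of pairwise disjoint sets with $|A|=|B|=|C|=|D|=n$ and $A\cup B\cup C\cup D=\{1,2,\dots,4n\}$; each die is fair and dice are rolled independently. For dice $X,Y$, $P(X\succ Y)=\frac{1}{n^2}|\{(x,y)\in X\times Y: x>y\}|$ is the probability that the number rolled on $X$ exceeds that rolled on $Y$. Such a set is non-transitive if each of $P(A\succ B),P(B\succ C),P(C\succ D),P(D\succ A)$ exceeds $1/2$, and balanced if these four probabilities are equal. *)

(* Defs.v *)
From mathcomp Require Import all_boot all_order all_algebra.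

Set Implicit Arguments.
Unset Strict Implicit.
Unset Printing Implicit Defensive.

Import Order.TTheory GRing.Theory Num.Theory.
Local Open Scope ring_scope.

(* A die is a set of elements of 'I_(4 * n).+1 = {0, ..., 4n}: the number on a
   face is the ordinal itself, and [dice_set] excludes 0 through the union
   condition, so that faces are numbered from 1 to 4n. *)
Definition die (n : nat) := {set 'I_(4 * n).+1}.

Definition dice_set (n : nat) (A B C D : die n) : Prop :=
  [/\ [/\ [disjoint A & B], [disjoint A & C] & [disjoint A & D]],
      [/\ [disjoint B & C], [disjoint B & D] & [disjoint C & D]],
      [/\ #|A| = n, #|B| = n, #|C| = n & #|D| = n]
    & A :|: B :|: C :|: D = [set i : 'I_(4 * n).+1 | (1 <= i <= 4 * n)%N]].

Definition win_prob (n : nat) (X Y : die n) : rat :=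
  #|[set xy in setX X Y | (xy.2 < xy.1)%N]|%:R / (n ^ 2)%:R.

Definition nontransitive (n : nat) (A B C D : die n) : Prop :=
  [/\ win_prob A B > 1 / 2, win_prob B C > 1 / 2,
      win_prob C D > 1 / 2 & win_prob D A > 1 / 2].

Definition balanced (n : nat) (A B C D : die n) : Prop :=
  [/\ win_prob A B = win_prob B C, win_prob B C = win_prob C D
    & win_prob C D = win_prob D A].

(* Main.v *)
Require Import Defs.
From mathcomp Require Import all_boot all_order all_algebra.
From mathcomp Require Import zify.

(** Write a set of dice as a word over {0, 1, 2, 3} whose i-th letter names the
    die carrying face i.  Concatenating the words of an n-sided and an m-sided
    set adds the excesses 2 * #wins - (#sides)^2, because every cross comparison
    is won by the later word and there are n * m of these out of 2 * n * m.
    Hence concatenation preserves balance and non-transitivity, and explicit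
    words for n = 3, 4, 5, extended by copies of the one for 3, cover all
    n >= 3. *)

Import GRing.Theory Num.Theory.

(** Faces increase along the word, so an occurrence of [d] loses to exactly the occurrences of [c]
    after it. *)
Fixpoint wins (c d : nat) (w : seq nat) : nat :=
  if w is x :: w' then (x == d) * count_mem c w' + wins c d w' else 0.

Lemma wins_cat c d u v :
  wins c d (u ++ v) = wins c d u + wins c d v + count_mem d u * count_mem c v.
Proof.
elim: u => [|x u IH]; first by rewrite /= mul0n addn0.
rewrite /= IH count_cat !mulnDl mulnDr -!addnA; congr (_ + _).
by rewrite addnCA; congr (_ + _); rewrite addnCA.
Qed.

Definition good_word (n : nat) (w : seq nat) : bool :=
  [&& size w == 4 * n, all (fun x => x < 4) w,
      all (fun c => count_mem c w == n) (iota 0 4),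
      all (fun c => wins c (c.+1 %% 4) w == wins 0 1 w) (iota 0 4)
    & n ^ 2 < 2 * wins 0 1 w].

Lemma good_word_cat n m u v :
  good_word n u -> good_word m v -> good_word (n + m) (u ++ v).
Proof.
case/and5P=> su au cu wu lu /and5P[sv av cv wv lv].
move: cu cv wu wv; rewrite /good_word size_cat all_cat au av /= !wins_cat !count_cat.
move=> /and5P[/eqP-> /eqP-> /eqP-> /eqP-> _].
move=> /and5P[/eqP-> /eqP-> /eqP-> /eqP-> _].
move=> /and5P[_ /eqP-> /eqP-> /eqP-> _] /and5P[_ /eqP-> /eqP-> /eqP-> _].
rewrite !eqxx (eqP su) (eqP sv) mulnDr eqxx sqrnD (modn_small (isT : 1 < 4)) /=; lia.
Qed.

(** Each die beats the next in 5 of 9, 9 of 16 and 13 of 25 comparisons respectively: the barest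
    majority in each case. *)
Definition word3 := [:: 2;0;3;1;1;0;3;2;3;2;1;0].
Definition word4 := [:: 3;2;1;1;2;0;0;0;3;3;2;3;1;2;0;1].
Definition word5 := [:: 3;2;1;1;0;2;0;3;0;3;1;2;0;2;3;1;3;2;0;1].

Lemma good_word_exists n : 3 <= n -> exists w, good_word n w.
Proof.
elim/ltn_ind: n => n IH; case: (ltnP n 6) => [n_lt6 n_ge3 | n_ge6 _].
  have /or3P[] : [|| n == 3, n == 4 | n == 5] by lia.
  - by move/eqP->; exists word3.
  - by move/eqP->; exists word4.
  - by move/eqP->; exists word5.
have [||w gw] := IH (n - 3); [lia | lia |].
by exists (w ++ word3); rewrite -(subnK (ltnW (ltnW (ltnW n_ge6)))) good_word_cat.
Qed.

(** [m] is separate from [u] because the face bound [(4 * n).+1] is only provably equal to the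
    length of the word used. When [m] is [size u], the default 4 is never reached. *)
Definition die_of (m : nat) (u : seq nat) (c : nat) : {set 'I_m} :=
  [set i : 'I_m | nth 4 u i == c].

Lemma card_die_of u c : #|die_of (size u) u c| = count_mem c u.
Proof.
rewrite -sum1_card -sum1_count (big_nth 4) big_mkord.
by apply: eq_bigl => i; rewrite inE.
Qed.

Lemma sum_wins c d u :
  \sum_(i < size u | nth 4 u i == c) \sum_(j < size u | (nth 4 u j == d) && (j < i)) 1
  = wins c d u.
Proof.
elim: u => [|x u IH]; first by rewrite big_ord0.
(* As the winner [i], position 0 contributes nothing: no position precedes it. *)
rewrite big_mkcond big_ord_recl /= big1 ?if_same ?add0n; last by move=> i /andP[].
rewrite -IH -sum1_count (big_nth 4) big_mkord big_distrr -big_split_idem //= -big_mkcond /=.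
(* As the loser [j], position 0 is beaten by every later [c] precisely when [x == d]. *)
apply: eq_bigr => i _; rewrite big_mkcond big_ord_recl /= andbT muln1 -big_mkcond.
by case: (x == d).
Qed.

Lemma card_wins c d u (m := size u) :
  #|[set xy in setX (die_of m u c) (die_of m u d) | xy.2 < xy.1]| = wins c d u.
Proof.
rewrite -sum_wins pair_big_dep /= sum1_card; apply: eq_card => -[i j].
by rewrite !inE -andbA.
Qed.

Lemma disjoint_die_of m u c d : c != d -> [disjoint die_of m u c & die_of m u d].
Proof.
move=> cd; rewrite -setI_eq0; apply/eqP/setP => i; rewrite !inE.
by apply/negbTE/negP => /andP[/eqP-> /eqP E]; rewrite E eqxx in cd.
Qed.

Theorem theorem4p6 (n : nat) (hn : (3 <= n)%N) :
  exists A B C D : die n,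
    [/\ dice_set A B C D, balanced A B C D & nontransitive A B C D].
Proof.
have [w /and5P[/eqP sw aw cw ww lw]] := good_word_exists n hn.
(* Position 0 carries the letter 4, which belongs to no die. *)
pose u := 4 :: w; have su : size u = (4 * n).+1 by rewrite /= sw.
pose X c : die n := die_of _ u c.
have cardX c : c < 4 -> #|X c| = n.
  move=> c4; rewrite /X -su card_die_of /= (_ : (4 == c) = false); last lia.
  by apply/eqP/(allP cw); rewrite mem_iota.
have winX c : c < 4 -> win_prob (X c) (X (c.+1 %% 4)) = ((wins 0 1 w)%:R / (n ^ 2)%:R)%R.
  move=> c4; rewrite /win_prob /X -su card_wins /=.
  rewrite (_ : (4 == _) = false) ?mul0n ?add0n; last lia.
  by congr (_%:R / _)%R; apply/eqP/(allP ww); rewrite mem_iota.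
have gt_half : (1 / 2 < (wins 0 1 w)%:R / (n ^ 2)%:R :> rat)%R.
  rewrite ltr_pdivlMr ?ltr0n ?expn_gt0 ?(leq_trans _ hn) // mul1r mulrC.
  by rewrite ltr_pdivrMr ?ltr0n // -natrM ltr_nat mulnC.
(* These types match [winX] by computing [c.+1 %% 4], which wraps 3 round to 0. *)
have w0 : win_prob (X 0) (X 1) = _ := winX 0 isT.
have w1 : win_prob (X 1) (X 2) = _ := winX 1 isT.
have w2 : win_prob (X 2) (X 3) = _ := winX 2 isT.
have w3 : win_prob (X 3) (X 0) = _ := winX 3 isT.
exists (X 0), (X 1), (X 2), (X 3); split; last 2 first.
- by rewrite /balanced w0 w1 w2 w3.
- by rewrite /nontransitive w0 w1 w2 w3.
split; try by split; rewrite ?cardX ?disjoint_die_of.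
apply/setP => -[[|i] i_lt]; rewrite !inE //=.
have {}i_lt : i < 4 * n by [].
rewrite i_lt.
(* A letter below 4 names one of the four dice, so face [i.+1] is covered. *)
have /(allP aw) : nth 4 w i \in w by rewrite mem_nth // sw.
by case: (nth 4 w i) => [|[|[|[]]]].
Qed.
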